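(* Let $(X,x_0)$ be any pointed topological space. Then the whisker topology on $\widetilde X$ is identical with the quotient topology on $\widetilde X$ induced by the surjection $\pi\colon P\big((X,x_0)^{(I,0)}\big)\to \widetilde X$, $\pi(\alpha)=[\alpha]$, where $P\big((X,x_0)^{(I,0)}\big)$ is the universal Peano space of the based path space $(X,x_0)^{(I,0)}$ equipped with the compact-open topology.
   Context: Let $I=[0,1]$. $(X,x_0)^{(I,0)}$ is the set of paths (continuous maps) $\alpha\colon I\to X$ with $\alpha(0)=x_0$. $\widetilde X$ is the set of homotopy classes $[\alpha]$ (rel. end-points) of paths in $X$ originating at $x_0$. The whisker topology on $\widetilde X$ is the one with basis $B([\alpha],U)=\{[\alpha\ast\beta]\}$, where $\alpha$ is a path in $X$ from $x_0$ to $x_1$, $U$ is a neighborhood of $x_1$ in $X$, and $\beta$ ranges over paths in $U$ originating at $x_1$. For a path-connected topological space $Y$, its universal Peano space (universal locally path-connected space) $P(Y)$ is the set $Y$ with the topology whose basis consists of all path components of open subsets of $Y$. *)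

(* Defs.v *)
From HB Require Import structures.
From mathcomp Require Import all_boot all_order all_algebra generic_quotient.
From mathcomp Require Import all_classical all_reals all_analysis.
From mathcomp Require Import lra.

Set Implicit Arguments.
Unset Strict Implicit.
Unset Printing Implicit Defensive.

Import Order.TTheory GRing.Theory Num.Theory.
Import numFieldNormedType.Exports.

Local Open Scope classical_set_scope.
Local Open Scope ring_scope.
Local Open Scope quotient_scope.

Section unit_interval.
Context (R : realType).

Definition unitI : Type := set_type [set` `[(0 : R), 1]].

HB.instance Definition _ := Topological.copy unitI (set_type [set` `[(0 : R), 1]]).

Definition unitI_val (t : unitI) : R := \val t.

Lemma to_unitI_subproof (x : R) :
  Num.max 0 (Num.min 1 x) \in [set` `[(0 : R), 1]].
Proof. by rewrite inE/= in_itv/= le_max lexx ge_max ler01 ge_min lexx. Qed.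

(* the retraction of R onto [0, 1] *)
Definition to_unitI (x : R) : unitI := SigSub (to_unitI_subproof x).

Lemma unitI_valP (t : unitI) : 0 <= unitI_val t <= 1.
Proof. by have := set_valP t; rewrite /= in_itv. Qed.

Lemma unitI_val_inj : injective unitI_val.
Proof. exact: val_inj. Qed.

Lemma to_unitIE (x : R) : 0 <= x <= 1 -> unitI_val (to_unitI x) = x.
Proof.
by move=> /andP[x0 x1]; rewrite /unitI_val/= min_r// max_r.
Qed.

Lemma to_unitIK (t : unitI) : to_unitI (unitI_val t) = t.
Proof. by apply/unitI_val_inj/to_unitIE/unitI_valP. Qed.

Lemma zero_one_unitI : to_unitI 0 != to_unitI 1.
Proof.
apply/eqP => /(congr1 unitI_val); rewrite !to_unitIE ?lexx ?ler01// => /esym.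
by apply/eqP; rewrite oner_eq0.
Qed.

HB.instance Definition _ := isBiPointed.Build unitI zero_one_unitI.

Lemma unitI_val0 : unitI_val zero = 0.
Proof. by rewrite to_unitIE// lexx ler01. Qed.

Lemma unitI_val1 : unitI_val one = 1.
Proof. by rewrite to_unitIE// lexx ler01. Qed.

Lemma unitI_val_continuous : continuous unitI_val.
Proof. exact: initial_continuous. Qed.

Lemma to_unitI_continuous (T : topologicalType) (f : T -> R) :
  continuous f -> continuous (to_unitI \o f).
Proof.
move=> cf; apply: (@continuous_comp_initial unitI T R unitI_val) => x.
apply: (@continuous_max R T (cst 0) (fun y => Num.min 1 (f y))).
  exact: cst_continuous.
apply: (@continuous_min R T (cst 1) f); first exact: cst_continuous.
exact: cf.
Qed.

End unit_interval.

Lemma pasting (R : realType) (T X : topologicalType) (p : T -> R) (c : R)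
    (f g : T -> X) : continuous p -> continuous f -> continuous g ->
  (forall t, p t = c -> f t = g t) ->
  continuous (fun t => if p t <= c then f t else g t).
Proof.
move=> cp cf cg fg t A /=.
case: (ltgtP (p t) c) => [ptc|ptc|ptc] At.
- have : \forall s \near t, p s < c by exact: cvgr_lt (cp t) _ ptc.
  by move=> /filterI/(_ (cf _ _ At)); apply: filterS => s [/= /ltW ->].
- have : \forall s \near t, c < p s by exact: cvgr_gt (cp t) _ ptc.
  move=> /filterI/(_ (cg _ _ At)); apply: filterS => s /= [].
  by rewrite ltNge => /negbTE ->.
- have At' := At; rewrite (fg _ ptc) in At'.
  have : nbhs t (f @^-1` A `&` g @^-1` A).
    by apply: filterI; [exact: cf | exact: cg].
  by apply: filterS => s [/= fs gs]; case: ifP.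
Qed.

Section homotopy.
Context (R : realType) (X : topologicalType).
Local Notation I := (unitI R).
Implicit Types f g h : I -> X.

Definition path_cat f g : I -> X := fun t =>
  if unitI_val t <= 2^-1 then f (to_unitI (2 * unitI_val t))
  else g (to_unitI (2 * unitI_val t - 1)).

(* homotopy relative to the end-points *)
Definition homotopic f g := exists H : I * I -> X,
  [/\ continuous H,
      (forall t, H (t, zero) = f t) /\ (forall t, H (t, one) = g t) &
      forall s, H (zero, s) = f zero /\ H (one, s) = f one].

Lemma affine_continuous (T : topologicalType) (p : T -> R) (a b : R) :
  continuous p -> continuous (fun t => a * p t + b).
Proof.
move=> cp t; apply: cvgD; last exact: cvg_cst.
by apply: cvgM; [exact: cvg_cst | exact: cp].
Qed.

Lemma scale_continuous (T : topologicalType) (p : T -> R) (a : R) :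
  continuous p -> continuous (fun t => a * p t).
Proof. by move=> cp t; apply: cvgM; [exact: cvg_cst | exact: cp]. Qed.

Lemma half_continuous (T : topologicalType) (p : T -> R) :
  continuous p ->
  continuous (fun t => to_unitI (2 * p t)) /\
  continuous (fun t => to_unitI (2 * p t - 1)).
Proof.
move=> cp; split.
- apply: (@to_unitI_continuous R T (fun t => 2 * p t)).
  exact: scale_continuous.
- apply: (@to_unitI_continuous R T (fun t => 2 * p t - 1)).
  exact: affine_continuous.
Qed.

Lemma to_unitI0 (x : R) : x = 0 -> to_unitI x = zero.
Proof. by move=> ->. Qed.

Lemma to_unitI1 (x : R) : x = 1 -> to_unitI x = one.
Proof. by move=> ->. Qed.

Lemma path_cat_continuous f g : continuous f -> continuous g ->
  f one = g zero -> continuous (path_cat f g).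
Proof.
move=> cf cg fg; have [c1 c2] := half_continuous (@unitI_val_continuous R).
apply: (@pasting R I X (@unitI_val R) 2^-1 (f \o _) (g \o _)).
- exact: unitI_val_continuous.
- by move=> t; apply: continuous_comp; [exact: c1 | exact: cf].
- by move=> t; apply: continuous_comp; [exact: c2 | exact: cg].
- move=> t /= ->; rewrite to_unitI1; last by lra.
  by rewrite to_unitI0 //; lra.
Qed.

Lemma path_cat0 f g : path_cat f g zero = f zero.
Proof.
rewrite /path_cat unitI_val0 ifT ?to_unitI0 ?mulr0//; lra.
Qed.

Lemma path_cat1 f g : path_cat f g one = g one.
Proof.
rewrite /path_cat unitI_val1 ifF ?to_unitI1//; last by apply/negbTE; lra.
lra.
Qed.

Lemma fstI_continuous : continuous (fun z : I * I => unitI_val z.1).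
Proof.
move=> z; apply: continuous_comp; first exact: cvg_fst.
exact: unitI_val_continuous.
Qed.

Lemma sndI_continuous : continuous (fun z : I * I => unitI_val z.2).
Proof.
move=> z; apply: continuous_comp; first exact: cvg_snd.
exact: unitI_val_continuous.
Qed.

Lemma continuous_pairI (T U V : topologicalType) (a : T -> U) (b : T -> V) :
  continuous a -> continuous b -> continuous (fun t => (a t, b t)).
Proof. by move=> ca cb t; apply: cvg_pair; [exact: ca | exact: cb]. Qed.

Lemma homotopic_ends f g : homotopic f g -> f zero = g zero /\ f one = g one.
Proof.
move=> [H [cH [H0 H1] He]]; have [e0 e1] := He one.
by rewrite -e0 -e1 !H1.
Qed.

Lemma homotopic_refl f : continuous f -> homotopic f f.
Proof.
move=> cf; exists (f \o fst); split => // z.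
by apply: continuous_comp; [exact: cvg_fst | exact: cf].
Qed.

Lemma homotopic_sym f g : homotopic f g -> homotopic g f.
Proof.
move=> fg; have [e0 e1] := homotopic_ends fg; move: fg => [H [cH [H0 H1] He]].
pose flip (s : I) : I := to_unitI (1 - unitI_val s).
exists (fun z => H (z.1, flip z.2)); split.
- have c : continuous (fun z : I * I => (z.1, flip z.2)).
    apply: continuous_pairI; first by move=> z; exact: cvg_fst.
    apply: (@to_unitI_continuous R _ (fun z : I * I => 1 - unitI_val z.2)) => z.
    by apply: cvgB; [exact: cvg_cst | exact: sndI_continuous].
  by move=> z; apply: (continuous_comp (c z)); exact: cH.
- split=> t /=; rewrite /flip.
  + by rewrite unitI_val0 subr0 to_unitI1.
  + by rewrite unitI_val1 subrr to_unitI0.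
- by move=> s /=; rewrite -e0 -e1; exact: He.
Qed.

Lemma homotopic_trans f g h :
  homotopic f g -> homotopic g h -> homotopic f h.
Proof.
move=> fg gh; have [e0 e1] := homotopic_ends fg.
move: fg gh => [H [cH [H0 H1] He]] [K [cK [K0 K1] Ke]].
have [c1 c2] := half_continuous sndI_continuous.
have cfst : continuous (@fst I I) by move=> z; exact: cvg_fst.
have d1 := continuous_pairI cfst c1; have d2 := continuous_pairI cfst c2.
exists (fun z => if unitI_val z.2 <= 2^-1
  then H (z.1, to_unitI (2 * unitI_val z.2))
  else K (z.1, to_unitI (2 * unitI_val z.2 - 1))); split.
- apply: (@pasting R _ X (fun z => unitI_val z.2) 2^-1 (H \o _) (K \o _)).
  + exact: sndI_continuous.
  + by move=> z; apply: (continuous_comp (d1 z)); exact: cH.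
  + by move=> z; apply: (continuous_comp (d2 z)); exact: cK.
  + move=> t /= ->; rewrite to_unitI1; last by lra.
    by rewrite to_unitI0 ?H1 ?K0//; lra.
- split=> t /=.
  + by rewrite unitI_val0 ifT ?to_unitI0 ?mulr0//; lra.
  + rewrite unitI_val1 ifF ?to_unitI1//; last by apply/negbTE; lra.
    lra.
- move=> s /=; case: ifP => _; first exact: He.
  by have [-> ->] := Ke (to_unitI (2 * unitI_val s - 1)).
Qed.

Lemma homotopic_continuous f g : homotopic f g -> continuous f.
Proof.
move=> [H [cH [H0 _] _]].
have -> : f = H \o (fun t => (t, zero)) by apply/funext => t /=.
have c : continuous (fun t : I => (t, zero : I)).
  by apply: continuous_pairI; [move=> t; exact: cvg_id | exact: cst_continuous].
by move=> t; apply: (continuous_comp (c t)); exact: cH.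
Qed.

Lemma homotopic_cat f f' g : homotopic f f' -> continuous g ->
  f one = g zero -> homotopic (path_cat f g) (path_cat f' g).
Proof.
move=> [H [cH [H0 H1] He]] cg fg.
have [c1 c2] := half_continuous fstI_continuous.
have csnd : continuous (@snd I I) by move=> z; exact: cvg_snd.
have d1 := continuous_pairI c1 csnd.
exists (fun z => if unitI_val z.1 <= 2^-1
  then H (to_unitI (2 * unitI_val z.1), z.2)
  else g (to_unitI (2 * unitI_val z.1 - 1))); split.
- apply: (@pasting R _ X (fun z => unitI_val z.1) 2^-1 (H \o _) (g \o _)).
  + exact: fstI_continuous.
  + by move=> z; apply: (continuous_comp (d1 z)); exact: cH.
  + by move=> z; apply: (continuous_comp (c2 z)); exact: cg.
  + move=> t /= ->; rewrite to_unitI1; last by lra.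
    by rewrite (He _).2 to_unitI0//; lra.
- by split=> t; rewrite /path_cat/= ?H0 ?H1.
- move=> s /=; rewrite path_cat0 path_cat1; split.
  + by rewrite unitI_val0 ifT ?to_unitI0 ?mulr0 ?(He _).1//; lra.
  + rewrite unitI_val1 ifF ?to_unitI1//; last by apply/negbTE; lra.
    lra.
Qed.

Lemma homotopic_reparam f (u v : I -> R) : continuous f ->
  continuous u -> continuous v -> u zero = v zero -> u one = v one ->
  homotopic (fun t => f (to_unitI (u t))) (fun t => f (to_unitI (v t))).
Proof.
move=> cf cu cv uv0 uv1.
pose w (z : I * I) := u z.1 + unitI_val z.2 * (v z.1 - u z.1).
have cw : continuous w.
  have cu1 : continuous (fun z : I * I => u z.1).
    by move=> z; apply: continuous_comp; [exact: cvg_fst | exact: cu].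
  have cv1 : continuous (fun z : I * I => v z.1).
    by move=> z; apply: continuous_comp; [exact: cvg_fst | exact: cv].
  move=> z; apply: cvgD; first exact: cu1.
  apply: cvgM; first exact: sndI_continuous.
  by apply: cvgB; [exact: cv1 | exact: cu1].
exists (fun z => f (to_unitI (w z))); split.
- have c := to_unitI_continuous cw.
  by move=> z; apply: (continuous_comp (c z)); exact: cf.
- split=> t; rewrite /w/=; congr (f (to_unitI _)).
  + by rewrite unitI_val0 mul0r addr0.
  + by rewrite unitI_val1 mul1r addrC subrK.
- by move=> s; rewrite /w/= uv0 uv1 !subrr !mulr0 !addr0.
Qed.

Lemma path_catl f g (x : R) : 0 <= x <= 1 -> x <= 2^-1 ->
  path_cat f g (to_unitI x) = f (to_unitI (2 * x)).
Proof. by move=> x01 x2; rewrite /path_cat to_unitIE// x2. Qed.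

Lemma path_catr f g (x : R) : 0 <= x <= 1 -> 2^-1 < x ->
  path_cat f g (to_unitI x) = g (to_unitI (2 * x - 1)).
Proof. by move=> x01 x2; rewrite /path_cat to_unitIE// leNgt x2. Qed.

Lemma homotopic_catA f g h : continuous f -> continuous g -> continuous h ->
  f one = g zero -> g one = h zero ->
  homotopic (path_cat (path_cat f g) h) (path_cat f (path_cat g h)).
Proof.
move=> cf cg ch fg gh.
pose k := path_cat f (path_cat g h).
have ck : continuous k.
  apply: path_cat_continuous => //; first exact: path_cat_continuous.
  by rewrite path_cat0.
pose u (t : I) : R := Num.min (2 * unitI_val t)
  (Num.min (unitI_val t + 4^-1) ((unitI_val t + 1) / 2)).
have cI := @unitI_val_continuous R.
have c1 := @scale_continuous I (@unitI_val R) 2 cI.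
have c2 : continuous (fun t : I => unitI_val t + 4^-1).
  under eq_fun do rewrite -[unitI_val _]mul1r; exact: affine_continuous.
have c3 : continuous (fun t : I => (unitI_val t + 1) / 2).
  under eq_fun do rewrite mulrDl mulrC; exact: affine_continuous.
have cu : continuous u.
  move=> t; apply: (@continuous_min R I _
    (fun t => Num.min (unitI_val t + 4^-1) ((unitI_val t + 1) / 2)) _ (c1 t)).
  exact: (@continuous_min R I _ _ _ (c2 t) (c3 t)).
have -> : path_cat (path_cat f g) h = (fun t => k (to_unitI (u t))).
  apply/funext => t; have /andP[t0 t1] := unitI_valP t.
  rewrite -[t in LHS]to_unitIK /k /u; move: (unitI_val t) t0 t1 => x x0 x1.
  case: (lerP x 4^-1) => x4.
    rewrite min_l; last by rewrite !le_min; apply/andP; split; lra.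
    by rewrite !path_catl//; try (apply/andP; split); lra.
  case: (lerP x 2^-1) => x2.
    rewrite min_r; last by rewrite !ge_min; apply/orP; left; lra.
    rewrite min_l; last by lra.
    rewrite path_catl; [|lra..].
    rewrite path_catr; [|lra..].
    rewrite path_catr; [|lra..].
    rewrite path_catl; [|lra..].
    by congr (g (to_unitI _)); lra.
  rewrite min_r; last by rewrite !ge_min; apply/orP; right; lra.
  rewrite min_r; last by lra.
  rewrite path_catr; [|lra..].
  rewrite path_catr; [|lra..].
  rewrite path_catr; [|lra..].
  by congr (h (to_unitI _)); lra.
rewrite -/k [X in homotopic _ X](_ : _ = (fun t => k (to_unitI (unitI_val t)))).
  apply: homotopic_reparam => //; rewrite /u ?unitI_val0 ?unitI_val1.
    by rewrite mulr0 min_l// le_min; apply/andP; split; lra.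
  rewrite min_r; last by rewrite ge_min; apply/orP; right; lra.
  by rewrite min_r; lra.
by apply/funext => t; rewrite to_unitIK.
Qed.

Lemma homotopic_cat_cst f :
  continuous f -> homotopic (path_cat f (cst (f one))) f.
Proof.
move=> cf; pose u (t : I) : R := Num.min (2 * unitI_val t) 1.
have cI := @unitI_val_continuous R.
have -> : path_cat f (cst (f one)) = (fun t => f (to_unitI (u t))).
  apply/funext => t; rewrite /path_cat /u; case: lerP => t2.
    by rewrite min_l//; lra.
  by rewrite min_r//; lra.
rewrite [X in homotopic _ X](_ : _ = (fun t => f (to_unitI (unitI_val t)))).
  apply: homotopic_reparam => //.
  - have c1 := @scale_continuous I (@unitI_val R) 2 cI.
    move=> t; apply: (@continuous_min R I _ (cst 1) _ (c1 t)).
    exact: cst_continuous.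
  - by rewrite /u unitI_val0 mulr0 min_l.
  - by rewrite /u unitI_val1 min_r//; lra.
by apply/funext => t; rewrite to_unitIK.
Qed.

End homotopy.

(* The paths starting at x0, as a subspace of the space of all functions with
   the compact-open topology. *)
Section based_path.
Context (R : realType) (X : topologicalType) (x0 : X).
Local Notation I := (unitI R).

Definition based_path : Type := set_type
  [set f : {compact-open, I -> X} | continuous (f : I -> X) /\ f zero = x0].

HB.instance Definition _ := Topological.copy based_path (set_type
  [set f : {compact-open, I -> X} | continuous (f : I -> X) /\ f zero = x0]).

Definition path_fun (a : based_path) : I -> X := \val a.

Lemma based_path_subproof (f : I -> X) : continuous f -> f zero = x0 ->
  f \in [set f : {compact-open, I -> X} |
          continuous (f : I -> X) /\ f zero = x0].
Proof. by move=> cf f0; rewrite inE. Qed.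

Definition mk_based_path (f : I -> X) (cf : continuous f) (f0 : f zero = x0) :
  based_path := SigSub (based_path_subproof cf f0).

Lemma path_fun_continuous (a : based_path) : continuous (path_fun a).
Proof. exact: (set_valP a).1. Qed.

Lemma path_fun0 (a : based_path) : path_fun a zero = x0.
Proof. exact: (set_valP a).2. Qed.

End based_path.

Coercion path_fun : based_path >-> Funclass.

Section concatenation.
Context (R : realType) (X : topologicalType) (x0 : X).
Variables (a : based_path R x0) (b : based_path R (a one)).

Lemma based_cat_continuous : continuous (path_cat a b).
Proof.
apply: path_cat_continuous; [exact: path_fun_continuous..|].
by rewrite path_fun0.
Qed.

Lemma based_cat0 : path_cat a b zero = x0.
Proof. by rewrite path_cat0 path_fun0. Qed.

Definition based_cat : based_path R x0 :=
  mk_based_path based_cat_continuous based_cat0.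

End concatenation.

Definition cst_path (R : realType) (X : topologicalType) (x : X) :
    based_path R x :=
  @mk_based_path R X x (cst x) (@cst_continuous (unitI R) X x) erefl.

(* the path component of y in the subspace U, for y in U *)
Definition path_component (R : realType) (Y : topologicalType)
    (U : set Y) (y : Y) : set Y :=
  [set z | exists b : based_path R y, range b `<=` U /\ b one = z].

(* The universal Peano space P(Y): a copy of Y whose topology has as a basis
   the path components of the open subsets of Y. *)
Definition peano (R : realType) (Y : Type) : Type := Y.

Section peano.
Context (R : realType) (Y : topologicalType).

Definition peano_basis : set (set Y) :=
  [set C | exists U y, [/\ open U, U y & C = path_component R U y]].

Lemma path_component_refl (U : set Y) (y : Y) : U y -> path_component R U y y.
Proof. by move=> Uy; exists (cst_path R y); split => // _ [t _ <-]. Qed.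

Lemma path_component_sub (U : set Y) (y : Y) : path_component R U y `<=` U.
Proof. by move=> z [b [bU <-]]; apply: bU; exists one. Qed.

Lemma range_path_cat (U : set Y) (f g : unitI R -> Y) :
  range f `<=` U -> range g `<=` U -> range (path_cat f g) `<=` U.
Proof.
move=> fU gU _ [t _ <-]; rewrite /path_cat.
by case: ifP => _; [apply: fU | apply: gU]; eexists.
Qed.

Lemma path_component_trans (U V : set Y) (y z : Y) :
  V `<=` U -> path_component R U y z ->
  path_component R V z `<=` path_component R U y.
Proof.
move=> VU [b [bU <-]] w [c [cV <-]]; exists (based_cat c); split.
  by apply: range_path_cat => //; exact: subset_trans VU.
exact: path_cat1.
Qed.

HB.instance Definition _ := Choice.on (peano R Y).

Lemma peano_basis_cover :
  \bigcup_(C in peano_basis) C = [set: peano R Y].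
Proof.
apply/seteqP; split => // y _.
exists (path_component R setT y); last exact: path_component_refl.
by exists setT, y; split => //; exact: openT.
Qed.

Lemma peano_basis_join (C D : set (peano R Y)) (y : peano R Y) :
  peano_basis C -> peano_basis D -> C y -> D y ->
  exists E : set (peano R Y), [/\ peano_basis E, E y & E `<=` C `&` D].
Proof.
move=> [U [u [oU Uu ->]]] [V [v [oV Vv ->]]] Cy Dy.
have UVy : (U `&` V) y by split; [move: Cy | move: Dy];
  exact: path_component_sub.
exists (path_component R (U `&` V) y); split.
- by exists (U `&` V), y; split => //; exact: openI.
- exact: path_component_refl.
- by rewrite subsetI; split; apply: path_component_trans.
Qed.

HB.instance Definition _ := @isBaseTopological.Build (peano R Y)
  (set (peano R Y)) peano_basis id peano_basis_cover peano_basis_join.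

End peano.

Section whisker.
Context (R : realType) (X : topologicalType) (x0 : X).
Implicit Types a b : based_path R x0.

Definition homotopicb a b := `[< homotopic a b >].

Lemma homotopicb_refl : reflexive homotopicb.
Proof.
by move=> a; apply/asboolP/homotopic_refl; exact: path_fun_continuous.
Qed.

Lemma homotopicb_sym : symmetric homotopicb.
Proof. by move=> a b; apply/asboolP/asboolP; exact: homotopic_sym. Qed.

Lemma homotopicb_trans : transitive homotopicb.
Proof.
move=> b a c /asboolP ab /asboolP bc.
by apply/asboolP; exact: homotopic_trans bc.
Qed.

Canonical homotopicb_equiv :=
  EquivRel homotopicb homotopicb_refl homotopicb_sym homotopicb_trans.

Definition path_classes : Type := {eq_quot homotopicb_equiv}.

HB.instance Definition _ := Choice.on path_classes.
HB.instance Definition _ := Quotient.on path_classes.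

Definition path_class a : path_classes := \pi_path_classes a.

Lemma path_classP a b : path_class a = path_class b <-> homotopic a b.
Proof.
split => [/eqmodP/asboolP//|ab].
by apply/eqmodP/asboolP.
Qed.

(* B([a], U) *)
Definition whisker_basic a (U : set X) : set path_classes :=
  [set path_class (based_cat b) | b in
    [set b : based_path R (a one) | range b `<=` U]].

(* The neighborhoods U of a(1) are open: for arbitrary neighborhoods the sets
   B([a], U) would not form a basis. *)
Definition whisker_basis : set (set path_classes) :=
  [set B | exists a U, open_nbhs (a one) U /\ B = whisker_basic a U].

Lemma whisker_basic_refl a (U : set X) :
  U (a one) -> whisker_basic a U (path_class a).
Proof.
move=> Ua; exists (cst_path R (a one)); first by move=> _ [t _ <-].
by apply/path_classP/homotopic_cat_cst; exact: path_fun_continuous.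
Qed.

Lemma whisker_basic_end a c (U : set X) :
  whisker_basic a U (path_class c) -> U (c one).
Proof.
move=> [b bU /path_classP/homotopic_ends[_ <-]].
by rewrite [X in U X]path_cat1; apply: bU; exists one.
Qed.

Lemma whisker_basic_trans a c (U V : set X) : V `<=` U ->
  whisker_basic a U (path_class c) -> whisker_basic c V `<=` whisker_basic a U.
Proof.
move=> VU [b bU /path_classP abc] _ [d dV <-].
have [_ e1] := homotopic_ends abc; rewrite [LHS]path_cat1 in e1.
have d0 : d zero = b one by rewrite e1 path_fun0.
pose d' := mk_based_path (@path_fun_continuous _ _ _ d) d0.
exists (based_cat d').
  by apply: range_path_cat => //; exact: subset_trans VU.
have [ca cb cd] : [/\ continuous a, continuous b & continuous d].
  by split; exact: path_fun_continuous.
apply/path_classP/(@homotopic_trans _ _ _ (path_cat (path_cat a b) d)).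
  by apply/homotopic_sym/homotopic_catA; rewrite ?path_fun0.
by apply: homotopic_cat => //; rewrite path_cat1.
Qed.

Definition whisker : Type := path_classes.

HB.instance Definition _ := Choice.on whisker.

Lemma whisker_basis_cover : \bigcup_(B in whisker_basis) B = [set: whisker].
Proof.
apply/seteqP; split => // c _; rewrite -[c]reprK.
exists (whisker_basic (repr c) setT); last exact: whisker_basic_refl.
by exists (repr c), setT; split => //; split => //; exact: openT.
Qed.

Lemma whisker_basis_join (B C : set whisker) (c : whisker) :
  whisker_basis B -> whisker_basis C -> B c -> C c ->
  exists D : set whisker, [/\ whisker_basis D, D c & D `<=` B `&` C].
Proof.
move=> [a [U [[oU _] ->]]] [b [V [[oV _] ->]]].
rewrite -[c]reprK; set e := repr c => aUe bVe.
have UVe : (U `&` V) (e one).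
  by split; [move: aUe | move: bVe]; exact: whisker_basic_end.
exists (whisker_basic e (U `&` V)); split.
- by exists e, (U `&` V); split => //; split => //; exact: openI.
- exact: whisker_basic_refl.
- by rewrite subsetI; split; apply: whisker_basic_trans.
Qed.

HB.instance Definition _ := @isBaseTopological.Build whisker
  (set whisker) whisker_basis id whisker_basis_cover whisker_basis_join.

(* A copy of path_classes registered as a quotient of the universal Peano space
   of the path space, along a |-> [a]. *)
Definition peano_path_classes : Type := path_classes.

Definition peano_class (a : peano R (based_path R x0)) : peano_path_classes :=
  path_class a.

Definition peano_repr (c : peano_path_classes) : peano R (based_path R x0) :=
  repr (c : path_classes).

Lemma peano_reprK : cancel peano_repr peano_class.
Proof. exact: reprK. Qed.

HB.instance Definition _ :=
  @isQuotient.Build (peano R (based_path R x0)) peano_path_classes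
    peano_repr peano_class peano_reprK.

Lemma pi_peano_path_classes (a : peano R (based_path R x0)) :
  \pi_peano_path_classes a = peano_class a.
Proof. by rewrite unlock. Qed.

End whisker.

Definition open_sets (T : topologicalType) : set_system T := [set A | open A].
Arguments open_sets T : clear implicits.

(* Main.v *)
Require Import Defs.
From mathcomp Require Import all_boot all_order all_algebra.
From mathcomp Require Import all_classical all_reals all_analysis.
From mathcomp Require Import lra.

(** Both topologies are compared through their bases, one inclusion each.

    Whisker-open sets are quotient-open.  If [W] contains the whisker
    neighborhood [B([a], U)], consider the open set [O] of the based paths that
    end in [U].  A path in [O] from [a] to [c] uncurries, the interval being
    compact Hausdorff, to a continuous square with left side [a], right side [c]
    and constant bottom side; its top side [b] runs in [U].  Sweeping the square
    gives a homotopy from [a * b] to [c] ([homotopic_square]), so [[c]] lies in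
    [B([a], U)]: the whole path component of [a] in [O] is mapped into [W]
    ([path_component_whisker]).

    Quotient-open sets are whisker-open.  Let the preimage of [A] contain the
    path component in an open set [N] of [a * const], which represents [[a]].
    Appending a constant is what makes room for whiskers: since the second half
    of [a * const] sits at [a(1)], there is a neighborhood [U] of [a(1)] such
    that [a * b] is in [N] for every path [b] in [U] ([nbhs_based_cat_cst]).
    Retracting [b] along itself to its origin stays in [U], and so gives a path
    in [N] from [a * const] to [a * b] ([path_component_based_cat]); hence
    [B([a], U)] is contained in [A]. *)

Set Implicit Arguments.
Unset Strict Implicit.
Unset Printing Implicit Defensive.

Import Order.TTheory GRing.Theory Num.Theory.
Import numFieldNormedType.Exports.

Local Open Scope classical_set_scope.
Local Open Scope ring_scope.

(** * The unit interval *)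

Lemma unitI_compact (R : realType) : compact [set: unitI R].
Proof.
have -> : [set: unitI R] = @to_unitI R @` `[0, 1].
  apply/esym/seteqP; split => // t _.
  exists (unitI_val t); last exact: to_unitIK.
  by rewrite /= in_itv /=; exact: unitI_valP.
apply: continuous_compact; last exact: segment_compact.
apply: continuous_subspaceT.
exact: (@to_unitI_continuous R R (fun x => x) (fun x => @cvg_id _ _)).
Qed.

Lemma unitI_locally_compact (R : realType) : locally_compact [set: unitI R].
Proof.
move=> t _; exists setT; first exact: filterT.
by split; [exact: unitI_compact | exact: closedT].
Qed.

Lemma unitI_regular (R : realType) : @regular_space (unitI R).
Proof. exact: (@uniform_regular (set_type [set` `[(0 : R), 1]])). Qed.

(** * Open sets in terms of basic neighborhoods of their points *)

Section bases.
Context (R : realType).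

(** A basic set that contains [y] need not be a component of [y] by definition,
    but it contains the component of [y] in the same open set; so the basic sets
    centered at [y] suffice to test openness at [y]. *)
Lemma peano_openP (Y : topologicalType) (A : set (peano R Y)) :
  open A <-> forall y : Y, A y ->
    exists2 U : set Y, open_nbhs y U & path_component R U y `<=` A.
Proof.
split=> [[D Dbasis <-] y [C DC Cy]|Anbhs].
  have [U [u [oU Uu CE]]] := Dbasis _ DC.
  exists U; first by split=> //; move: Cy; rewrite CE; exact: path_component_sub.
  apply: subset_trans (bigcup_sup DC); move: Cy; rewrite /= CE => Cy.
  exact: path_component_trans.
exists [set C | @peano_basis R Y C /\ C `<=` A]; first by move=> C [].
apply/seteqP; split=> [y [C [_ CA] /CA//]|y /[dup] Ay /Anbhs[U [oU Uy] UA]].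
exists (path_component R U y); last exact: path_component_refl.
by split=> //; exists U, y.
Qed.

(** As in [peano_openP], whisker neighborhoods can be recentered at any of their
    points without changing [U]. *)
Lemma whisker_openP (X : topologicalType) (x0 : X) (A : set (whisker R x0)) :
  open A <-> forall a : based_path R x0, A (path_class a) ->
    exists2 U : set X, open_nbhs (a one) U & whisker_basic a U `<=` A.
Proof.
split=> [[D Dbasis <-] a [B DB Ba]|Anbhs].
  have [c [U [[oU _] BE]]] := Dbasis _ DB.
  rewrite /= BE in Ba.
  exists U; first by split=> //; exact: whisker_basic_end Ba.
  apply: subset_trans (bigcup_sup DB); rewrite /= BE.
  exact: whisker_basic_trans.
exists [set B | @whisker_basis R X x0 B /\ B `<=` A]; first by move=> B [].
apply/seteqP; split=> [c [B [_ BA] /BA//]|c].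
have <- : path_class (repr (c : path_classes R x0)) = c by exact: reprK.
move: (repr _) => a /Anbhs[U aU UA].
exists (whisker_basic a U); last exact: whisker_basic_refl aU.2.
by split=> //; exists a, U.
Qed.

End bases.

(** * Maps into the based path space *)

Section path_space.
Context (R : realType) (X : topologicalType).
Local Notation I := (unitI R).

Lemma based_path_eq (x : X) (a b : based_path R x) : a =1 b -> a = b.
Proof. by move=> ab; apply: val_inj; exact/funext. Qed.

(** This is where the choice of the compact-open topology matters: over the
    locally compact regular space [I] it makes evaluation jointly continuous. *)
Lemma based_path_uncurry_continuous (T : topologicalType) (x : X)
    (f : T -> based_path R x) : continuous f ->
  continuous (fun z : T * I => f z.1 z.2).
Proof.
move=> cf.
have -> : (fun z : T * I => f z.1 z.2) = uncurry (fun t => (f t : I -> X)).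
  by apply/funext => -[].
apply: continuous_uncurry_regular.
- exact: unitI_locally_compact.
- exact: unitI_regular.
- have cv : continuous
      (fun a : based_path R x => \val a : {compact-open, I -> X}).
    exact: initial_continuous.
  by move=> t; exact: (continuous_comp (cf t) (cv _)).
- by move=> t; exact: path_fun_continuous.
Qed.

Lemma based_path_curry_continuous (T : topologicalType) (x : X)
    (f : T -> based_path R x) :
  continuous (fun z : T * I => f z.1 z.2) -> continuous f.
Proof.
move=> /continuous_curry_fun cf; apply: continuous_comp_initial; exact: cf.
Qed.

Lemma based_path_eval_continuous (x : X) (t : I) :
  continuous (fun a : based_path R x => a t).
Proof.
have ev := based_path_uncurry_continuous (fun a : based_path R x => @cvg_id _ _).
have cp := continuous_pairI (fun a : based_path R x => @cvg_id _ (nbhs a))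
  (@cst_continuous _ _ t).
by move=> a; exact: (continuous_comp (cp a) (@ev _)).
Qed.

(** * Paths of based paths give whiskers *)

(** The left side followed by the top side, and the right side, are the images
    under [G] of two paths in the square that start on the bottom side and end
    at the top right corner.  The square is convex, so the segments between
    corresponding points join these paths; the origins slide along the bottom
    side, where [G] is constant. *)
Lemma homotopic_square (G : I * I -> X) : continuous G ->
  (forall s, G (s, zero) = G (zero, zero)) ->
  homotopic (path_cat (fun t => G (zero, t)) (fun s => G (s, one)))
            (fun t => G (one, t)).
Proof.
move=> cG G0.
have clamp0 (x : R) : x <= 0 -> to_unitI x = zero.
  move=> x0; apply: unitI_val_inj.
  by rewrite unitI_val0 /unitI_val /= max_l// ge_min x0 orbT.
have clamp1 (x : R) : 1 <= x -> to_unitI x = one.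
  move=> x1; apply: unitI_val_inj.
  by rewrite unitI_val1 /unitI_val /= min_l ?max_r.
(* The retraction of the line onto the interval absorbs the case distinction:
   the concatenation follows (2t - 1, 2t), retracted to the square. *)
have catE t : path_cat (fun t => G (zero, t)) (fun s => G (s, one)) t =
    G (to_unitI (2 * unitI_val t - 1), to_unitI (2 * unitI_val t)).
  rewrite /path_cat; case: lerP => t2.
    by rewrite [to_unitI (_ - 1)]clamp0//; lra.
  by rewrite [to_unitI (2 * _)]clamp1//; lra.
(* For z = (t, r), the point (u z, v z) is at time r on the segment from
   (2t - 1, 2t) to (1, t). *)
pose u (z : I * I) :=
  2 * unitI_val z.1 - 1 + unitI_val z.2 * (2 - 2 * unitI_val z.1).
pose v (z : I * I) := 2 * unitI_val z.1 - unitI_val z.2 * unitI_val z.1.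
have c1 : continuous (fun z : I * I => unitI_val z.1) by exact: fstI_continuous.
have c2 : continuous (fun z : I * I => unitI_val z.2) by exact: sndI_continuous.
have cu : continuous u.
  move=> z; apply: cvgD; first exact: (@Defs.affine_continuous R _ _ 2 (- 1) c1).
  apply: cvgM; first exact: c2.
  apply: cvgB; first exact: cvg_cst.
  exact: (@Defs.scale_continuous R _ _ 2 c1).
have cv : continuous v.
  move=> z; apply: cvgB; first exact: (@Defs.scale_continuous R _ _ 2 c1).
  by apply: cvgM; [exact: c2 | exact: c1].
exists (fun z => G (to_unitI (u z), to_unitI (v z))); split.
- have cuv := continuous_pairI (to_unitI_continuous cu) (to_unitI_continuous cv).
  by move=> z; exact: (continuous_comp (cuv z) (@cG _)).
- split=> t; rewrite /u /v /= ?unitI_val0 ?unitI_val1.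
  + by rewrite catE !mul0r addr0 subr0.
  + rewrite to_unitI1; last by lra.
    by congr (G (_, _)); rewrite -[RHS]to_unitIK; congr to_unitI; lra.
- move=> s; rewrite /u /v /= path_cat0 path_cat1 unitI_val0 unitI_val1; split.
  + by rewrite [to_unitI (_ - _ * 0)]to_unitI0 ?G0//; lra.
  + have /andP[s0 s1] := unitI_valP s.
    by rewrite to_unitI1 ?clamp1//; lra.
Qed.

(** The whisker is the track of the end-points of the given path of paths. *)
Lemma path_component_whisker (x0 : X) (U : set X) (a c : based_path R x0) :
  path_component R [set g : based_path R x0 | U (g one)] a c ->
  whisker_basic a U (path_class c).
Proof.
move=> [g [gU gc]].
have cG := based_path_uncurry_continuous (@path_fun_continuous _ _ _ g).
pose G (z : I * I) := path_fun (g z.1) z.2.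
have cb : continuous (fun s => G (s, one)).
  have cg : continuous g by exact: path_fun_continuous.
  move=> s.
  exact: (continuous_comp (cg s) (@based_path_eval_continuous _ _ _)).
have b0 : G (zero, one) = a one by rewrite /G path_fun0.
exists (mk_based_path cb b0).
  by move=> _ [s _ <-]; apply: (gU (g s)); exists s.
apply/path_classP.
have aE : (a : I -> X) = fun t => G (zero, t) by rewrite /G /= path_fun0.
have cE : (c : I -> X) = fun t => G (one, t) by rewrite /G /= gc.
suff: homotopic (path_cat a (fun s => G (s, one))) c by [].
by rewrite aE cE; apply: homotopic_square => // s; rewrite /G !path_fun0.
Qed.

(** * Whiskers give paths of based paths *)

(** The sets [M] that contain [a * b] for all sufficiently small whiskers [b]
    form a filter, so that convergence need only be tested on the subbasic sets
    of the compact-open topology. *)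
Lemma nbhs_based_cat_cst (x0 : X) (a : based_path R x0)
    (N : set (based_path R x0)) :
  nbhs (based_cat (cst_path R (a one))) N ->
  exists2 U : set X, open_nbhs (a one) U &
    forall b : based_path R (a one), range b `<=` U -> N (based_cat b).
Proof.
pose F : set_system {compact-open, I -> X} := fun M =>
  exists2 U : set X, open_nbhs (a one) U &
    forall b : based_path R (a one), range b `<=` U -> M (path_cat a b).
have FF : Filter F.
  split.
  - by exists setT => //; exact: open_nbhsT.
  - move=> P Q [U aU UP] [V aV VQ]; exists (U `&` V); first exact: open_nbhsI.
    by move=> b; rewrite subsetI => -[bU bV]; split; [exact: UP | exact: VQ].
  - by move=> P Q PQ [U aU UP]; exists U => // b bU; exact/PQ/UP.
pose p : {compact-open, I -> X} := path_cat a (cst (a one)).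
have Fp : F --> p.
  apply/compact_open_cvgP => K O cK oO pKO.
  (* If K meets the second half of I, then p takes there the value a(1), so O
     itself is the neighborhood sought; otherwise b has no effect on K. *)
  case: (pselect (exists2 t, K t & 2^-1 < unitI_val t)) => [[t Kt t2]|Kle].
    have Oa : O (a one).
      by apply: pKO; exists t => //; rewrite /p /path_cat leNgt t2.
    exists O => // b bO _ [s Ks <-].
    have := pKO _ (imageP p Ks); rewrite /p /path_cat.
    by case: ifP => // _ _; apply: bO; exists (to_unitI (2 * unitI_val s - 1)).
  exists setT; first exact: open_nbhsT.
  move=> b _ _ [s Ks <-]; have := pKO _ (imageP p Ks); rewrite /p /path_cat.
  by case: lerP => // s2; case: Kle; exists s.
case=> _ [] [] O oO <- pO ON.
have [U aU UO] : F O by apply: Fp; apply: open_nbhs_nbhs.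
by exists U => // b bU; apply: ON; exact: UO.
Qed.

(** The paths [t |-> b (s t)], for [s] from 0 to 1, grow the whisker from the
    constant path to [b] within the range of [b]. *)
Lemma path_component_based_cat (x0 : X) (a : based_path R x0)
    (b : based_path R (a one)) (N : set (based_path R x0)) :
  (forall c : based_path R (a one), range c `<=` range b -> N (based_cat c)) ->
  path_component R N (based_cat (cst_path R (a one))) (based_cat b).
Proof.
move=> Nb; have cb := @path_fun_continuous _ _ _ b.
have c1 := @fstI_continuous R; have c2 := @sndI_continuous R.
pose k (z : I * I) := b (to_unitI (unitI_val z.1 * unitI_val z.2)).
have ck : continuous k.
  have cm : continuous (fun z : I * I => unitI_val z.1 * unitI_val z.2).
    by move=> z; apply: cvgM; [exact: c1 | exact: c2].
  have cm' := to_unitI_continuous cm.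
  by move=> z; exact: (continuous_comp (cm' z) (@cb _)).
have ks s : continuous (fun t => k (s, t)).
  have cp := continuous_pairI (@cst_continuous _ _ s)
    (fun t : I => @cvg_id _ (nbhs t)).
  by move=> t; exact: (continuous_comp (cp t) (@ck _)).
have k0 s : k (s, zero) = a one.
  by rewrite /k unitI_val0 mulr0 [to_unitI _]to_unitI0// path_fun0.
pose c s : based_path R (a one) := mk_based_path (ks s) (k0 s).
have cc : continuous (fun s => based_cat (c s)).
  apply: based_path_curry_continuous.
  have [h1 h2] := half_continuous c2.
  apply: (@pasting R (I * I)%type X (fun z => unitI_val z.2) 2^-1
    (fun z => a (to_unitI (2 * unitI_val z.2)))
    (fun z => k (z.1, to_unitI (2 * unitI_val z.2 - 1)))).
  - exact: c2.
  - by move=> z; exact: (continuous_comp (h1 z) (@path_fun_continuous _ _ _ _ _)).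
  - have cfst : continuous (fun z : I * I => z.1) by move=> z; exact: cvg_fst.
    have cp := continuous_pairI cfst h2.
    by move=> z; exact: (continuous_comp (cp z) (@ck _)).
  - move=> z ->; rewrite to_unitI1; last by lra.
    by rewrite [to_unitI (_ - 1)]to_unitI0 ?k0//; lra.
have cz : based_cat (c zero) = based_cat (cst_path R (a one)).
  congr based_cat; apply: based_path_eq => t.
  suff: k (zero, t) = a one by [].
  by rewrite /k unitI_val0 mul0r [to_unitI _]to_unitI0// path_fun0.
have co : based_cat (c one) = based_cat b.
  congr based_cat; apply: based_path_eq => t.
  suff: k (one, t) = b t by [].
  by rewrite /k unitI_val1 mul1r to_unitIK.
exists (mk_based_path cc cz); split => //.
move=> _ [s _ <-]; apply: Nb => _ [t _ <-].
by exists (to_unitI (unitI_val s * unitI_val t)).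
Qed.

End path_space.

(** * The two topologies agree *)

Theorem theorem4p4 (R : realType) (X : topologicalType) (x0 : X) :
  open_sets (whisker R x0) =
  open_sets (quotient_topology (peano_path_classes R x0)).
Proof.
apply/seteqP; split => A; rewrite /open_sets /=.
- move=> oA; apply/peano_openP => a.
  rewrite /preimage /= pi_peano_path_classes => Aa.
  have [U [oU Ua] UA] := (whisker_openP A).1 oA a Aa.
  exists [set g : based_path R x0 | U (g one)].
    split => //; move/continuousP: (@based_path_eval_continuous R X x0 one).
    by apply.
  move=> c /path_component_whisker/UA.
  by rewrite /= pi_peano_path_classes.
- move=> /peano_openP oA; apply/whisker_openP => a Aa.
  have aE : path_class (based_cat (cst_path R (a one))) = path_class a.
    by apply/path_classP/homotopic_cat_cst; exact: path_fun_continuous.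
  have [|N aN NA] := oA (based_cat (cst_path R (a one))).
    by rewrite /preimage /= pi_peano_path_classes /peano_class aE.
  have [U aU UN] := nbhs_based_cat_cst (open_nbhs_nbhs aN).
  exists U => // _ [b bU <-].
  have /NA : path_component R N (based_cat (cst_path R (a one))) (based_cat b).
    apply: path_component_based_cat => c cb; apply: UN.
    exact: subset_trans cb bU.
  by rewrite /preimage /= pi_peano_path_classes.
Qed.
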